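(* Let $H=\mathbb{R}^n$ or $H=\mathbb{C}^n$, and let $\mathcal{F}=\{f_1,\ldots,f_m\}\subset H$ be a set of $m$ vectors. The following conditions are equivalent: (1) For any disjoint partition $\mathcal{F}=\mathcal{F}_1\cup\mathcal{F}_2$, either $\mathcal{F}_1$ spans $H$ or $\mathcal{F}_2$ spans $H$. (2) For any two vectors $x,y\in H$, if $x\neq 0$ and $y\neq 0$ then $\sum_{k=1}^m |\langle x,f_k\rangle|^2|\langle y,f_k\rangle|^2>0$. (3) There is a real constant $a_0>0$ such that for all $x,y\in H$, $\sum_{k=1}^m |\langle x,f_k\rangle|^2|\langle y,f_k\rangle|^2\geq a_0\|x\|^2\|y\|^2$. (4) There is a real constant $a_0>0$ such that for all $x\in H$, $R(x):=\sum_{k=1}^m |\langle x,f_k\rangle|^2\,\langle\cdot,f_k\rangle f_k\geq a_0\|x\|^2 I$, where the inequality is in the sense of quadratic forms.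
   Context: $H$ is the $n$-dimensional Hilbert space $\mathbb{R}^n$ or $\mathbb{C}^n$ ($n\ge 1$) with its standard scalar product $\langle\cdot,\cdot\rangle$ (linear in the first argument) and norm $\|\cdot\|$. The operator $\langle\cdot,f_k\rangle f_k$ maps $z\in H$ to $\langle z,f_k\rangle f_k$, and $I$ is the identity operator on $H$. An inequality $A\ge B$ of self-adjoint operators in the sense of quadratic forms means $\langle Az,z\rangle\geq\langle Bz,z\rangle$ for all $z\in H$. In a disjoint partition $\mathcal{F}=\mathcal{F}_1\cup\mathcal{F}_2$ the two parts are disjoint, and a part is allowed to be empty. *)

(* Defs.v *)
From HB Require Import structures.
From mathcomp Require Import all_boot all_order all_algebra.
From mathcomp Require Import reals.
From mathcomp Require Import complex.

Set Implicit Arguments.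
Unset Strict Implicit.
Unset Printing Implicit Defensive.

Import Order.TTheory GRing.Theory Num.Theory.
Local Open Scope ring_scope.

Variant scalar_kind := RealScalars | ComplexScalars.

Section Scalars.
Variable R : realType.

(* In both cases `|z| is the modulus of z (as an element of the scalar field),
   and u <= v in R[i] means that v - u is a nonnegative real. *)
Definition scalar_field (k : scalar_kind) : numFieldType :=
  match k with RealScalars => R | ComplexScalars => R[i] end.

Definition scalar_conj (k : scalar_kind) : scalar_field k -> scalar_field k :=
  match k with RealScalars => fun x => x | ComplexScalars => @conjc R end.

Definition scalar_Re (k : scalar_kind) : scalar_field k -> R :=
  match k with RealScalars => fun x => x | ComplexScalars => @complex.Re R end.

Definition of_real (k : scalar_kind) : R -> scalar_field k :=
  match k with RealScalars => fun x => x | ComplexScalars => real_complex R end.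

End Scalars.

Section Frames.
Variables (R : realType) (k : scalar_kind) (n m : nat).
Local Notation K := (scalar_field R k).
Local Notation H := 'rV[K]_n.
Implicit Types (x y z : H) (f : 'I_m -> H).

Definition dot x y : K := \sum_(i < n) x 0 i * scalar_conj (y 0 i).

(* The library norm `|x| on row vectors is the sup norm, hence this one. *)
Definition hnorm x : R := Num.sqrt (scalar_Re (dot x x)).

Definition spans f (A : {set 'I_m}) : Prop :=
  (<<[seq f j | j in A]>> = fullv)%VS.

Definition form_ge (A B : H -> H) : Prop :=
  forall z, dot (B z) z <= dot (A z) z.

Definition rank_one (v : H) : H -> H := fun z => dot z v *: v.

Definition frame_op f x : H -> H :=
  fun z => \sum_(j < m) `|dot x (f j)| ^+ 2 *: rank_one (f j) z.

End Frames.

(* Main.v *)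
(* (1) implies (3) needs no compactness. If F_1 is the set of k where
   |<x,f_k>|^2 is below a small multiple of |x|^2, then F_1 violates the
   lower frame bound that every spanning family satisfies, so the complement
   of F_1 spans, and its lower frame bound at y gives (3). The lower frame
   bound itself holds because |<x,v>|^2 is bounded by a multiple of the frame
   sum for v = f_k, and the set of such v is a subspace. *)
Require Import Defs.
From mathcomp Require Import all_boot all_order all_algebra.
From mathcomp Require Import reals complex.
From mathcomp Require Import ring.
Import Order.TTheory GRing.Theory Num.Theory.
Local Open Scope ring_scope.

(** * Conjugation and real scalars, uniformly in both fields *)

Section ScalarTheory.
Set Implicit Arguments.
Unset Strict Implicit.
Variables (R : realType) (k : scalar_kind).
Local Notation K := (scalar_field R k).
Local Notation conj := (@scalar_conj R k).
Implicit Types (a b : K) (r s : R).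

Lemma scalar_conjD a b : conj (a + b) = conj a + conj b.
Proof. by case: k a b => //= a b; rewrite rmorphD. Qed.

Lemma scalar_conjM a b : conj (a * b) = conj a * conj b.
Proof. by case: k a b => //= a b; rewrite rmorphM. Qed.

Lemma scalar_conj0 : conj 0 = 0.
Proof. by case: k => //; exact: (rmorph0 (@conjc R)). Qed.

Lemma scalar_conj1 : conj 1 = 1.
Proof. by case: k => //; exact: (rmorph1 (@conjc R)). Qed.

Lemma scalar_conjK a : conj (conj a) = a.
Proof. by case: k a => //= a; rewrite conjcK. Qed.

Lemma mul_scalar_conj a : a * conj a = `|a| ^+ 2.
Proof.
case: k a => /= a; first by rewrite -expr2 real_normK ?num_real.
by rewrite sqr_normc.
Qed.

Lemma of_realM r s : of_real k (r * s) = of_real k r * of_real k s.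
Proof. by case: k => //=; rewrite rmorphM. Qed.

Lemma of_real_gt0 r : (0 < of_real k r) = (0 < r).
Proof. by case: k => //=; rewrite ltcR. Qed.

Lemma of_real_Re a : 0 <= a -> of_real k (scalar_Re a) = a.
Proof. by case: k a => //= a a0; rewrite complex.RRe_real ?ger0_real. Qed.

End ScalarTheory.

Section FrameTheory.
Set Implicit Arguments.
Unset Strict Implicit.
Variables (R : realType) (k : scalar_kind) (n m : nat).
Local Notation K := (scalar_field R k).
Local Notation H := 'rV[K]_n.
Local Notation conj := (@scalar_conj R k).
Implicit Types (x y z v w : H) (a : K) (A : {set 'I_m}).

(** * The scalar product *)

Lemma conj_dot x y : conj (dot x y) = dot y x.
Proof.
rewrite /dot (big_morph conj (@scalar_conjD R k) (@scalar_conj0 R k)).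
by apply: eq_bigr => i _; rewrite scalar_conjM scalar_conjK mulrC.
Qed.

Lemma dotDl x y z : dot (x + y) z = dot x z + dot y z.
Proof. by rewrite /dot -big_split; apply: eq_bigr => i _; rewrite mxE mulrDl. Qed.

Lemma dotZl a x z : dot (a *: x) z = a * dot x z.
Proof. by rewrite /dot mulr_sumr; apply: eq_bigr => i _; rewrite mxE mulrA. Qed.

Lemma dot0l z : dot 0 z = 0.
Proof. by rewrite -(scale0r 0) dotZl mul0r. Qed.

Lemma dotDr x y z : dot z (x + y) = dot z x + dot z y.
Proof. by rewrite -conj_dot dotDl scalar_conjD !conj_dot. Qed.

Lemma dotZr a x z : dot z (a *: x) = conj a * dot z x.
Proof. by rewrite -conj_dot dotZl scalar_conjM conj_dot. Qed.

Lemma dot0r z : dot z 0 = 0.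
Proof. by rewrite -conj_dot dot0l scalar_conj0. Qed.

Lemma dot_delta x i : dot x (delta_mx 0 i) = x 0 i.
Proof.
rewrite /dot (bigD1 i) //= big1 ?addr0 => [|j /negPf ji].
  by rewrite mxE !eqxx scalar_conj1 mulr1.
by rewrite mxE ji andbF scalar_conj0 mulr0.
Qed.

Lemma dotxx x : dot x x = \sum_i `|x 0 i| ^+ 2.
Proof. by apply: eq_bigr => i _; rewrite mul_scalar_conj. Qed.

Lemma dotxx_ge0 x : 0 <= dot x x.
Proof. by rewrite dotxx sumr_ge0 // => i _; rewrite exprn_ge0. Qed.

Lemma dotxx_eq0 x : (dot x x == 0) = (x == 0).
Proof.
apply/idP/eqP => [|->]; last by rewrite dot0l.
rewrite dotxx psumr_eq0 => [/allP x0|i _]; last by rewrite exprn_ge0.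
apply/rowP => i; rewrite mxE; apply/eqP.
by have := x0 i (mem_index_enum _); rewrite /= sqrf_eq0 normr_eq0.
Qed.

Lemma dotxx_gt0 x : (0 < dot x x) = (x != 0).
Proof. by rewrite lt_def dotxx_ge0 andbT dotxx_eq0. Qed.

(** [dot x x] is nonnegative, hence real also in the complex case, so taking its real part loses
    nothing. *)
Lemma of_real_hnorm x : of_real k (hnorm x ^+ 2) = dot x x.
Proof.
rewrite /hnorm sqr_sqrtr ?of_real_Re ?dotxx_ge0 //.
have := dotxx_ge0 x; case: k x => //= x.
by rewrite lecE => /andP[].
Qed.

(** * Frame sums and lower frame bounds *)

Variable f : 'I_m -> H.

Definition frame_sum A x : K := \sum_(j in A) `|dot x (f j)| ^+ 2.

Lemma frame_sum_ge0 A x : 0 <= frame_sum A x.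
Proof. by rewrite sumr_ge0 // => j _; rewrite exprn_ge0. Qed.

Lemma dot_frame_op x z :
  dot (frame_op f x z) z = \sum_j `|dot x (f j)| ^+ 2 * `|dot z (f j)| ^+ 2.
Proof.
rewrite /frame_op (big_morph (fun u => dot u z) (fun u v => dotDl u v z) (dot0l z)).
by apply: eq_bigr => j _; rewrite !dotZl -(conj_dot z) mul_scalar_conj.
Qed.

Lemma span_dot_bound A v : v \in <<[seq f j | j in A]>>%VS ->
  exists2 C, 0 <= C & forall x, `|dot x v| ^+ 2 <= C * frame_sum A x.
Proof.
move=> /coord_span ->; apply: (big_ind (fun v => exists2 C, 0 <= C &
  forall x, `|dot x v| ^+ 2 <= C * frame_sum A x)).
- by exists 0 => // x; rewrite dot0r normr0 expr0n mul0r.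
- move=> u w [C C0 hC] [D D0 hD]; exists (2 * C + 2 * D).
    by rewrite addr_ge0 // mulr_ge0.
  move=> x; rewrite dotDr.
  have uw := ler_normD (dot x u) (dot x w).
  apply: (@le_trans _ _ ((`|dot x u| + `|dot x w|) ^+ 2)).
    by rewrite lerXn2r ?nnegrE ?addr_ge0.
  (* This square is the difference of the two sides of $(a+b)^2 \le 2a^2+2b^2$. *)
  have ac : 0 <= (`|dot x u| - `|dot x w|) ^+ 2.
    by rewrite real_exprn_even_ge0 ?rpredB ?normr_real.
  apply: (@le_trans _ _ (2 * `|dot x u| ^+ 2 + 2 * `|dot x w| ^+ 2)).
    rewrite -subr_ge0; apply: le_trans ac _; rewrite le_eqVlt; apply/orP; left.
    by apply/eqP; ring.
  by rewrite [(_ + _) * frame_sum A x]mulrDl -!mulrA lerD // ler_pM2l ?ltr0n.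
- move=> i _; set X := image_tuple _ _.
  have /imageP[j jA Xj] : X`_i \in [seq f j | j in A] by rewrite mem_nth ?size_tuple.
  (* The term of index [j] alone is at most the whole frame sum. *)
  exists (`|conj (coord X i v)| ^+ 2); first by rewrite exprn_ge0.
  move=> x; rewrite dotZr normrM exprMn Xj ler_wpM2l ?exprn_ge0 //.
  rewrite /frame_sum (bigD1 j) //= lerDl sumr_ge0 // => ? _.
  by rewrite exprn_ge0.
Qed.

(** Each standard basis vector lies in the span, which bounds each coordinate of [x]; the constants
    add up over the coordinates. *)
Lemma spans_lower_bound A : spans f A ->
  exists2 C, 0 <= C & forall x, dot x x <= C * frame_sum A x.
Proof.
move=> spA; have hb i : exists C, 0 <= C /\
    forall x, `|x 0 i| ^+ 2 <= C * frame_sum A x.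
  have [|C C0 hC] := @span_dot_bound A (delta_mx 0 i).
    by rewrite (spA : <<_>>%VS = _) memvf.
  by exists C; split=> // x; rewrite -dot_delta.
have [C hC] := fin_all_exists hb.
exists (\sum_i C i) => [|x]; first by rewrite sumr_ge0 // => i _; case: (hC i).
by rewrite dotxx mulr_suml ler_sum // => i _; case: (hC i).
Qed.

(** There are only finitely many index sets, so the sum of their constants serves them all. *)
Lemma uniform_lower_bound : exists2 C : K, 0 < C &
  forall A, spans f A -> forall x, dot x x <= C * frame_sum A x.
Proof.
have hb A : exists C : K, 0 <= C /\
    (spans f A -> forall x, dot x x <= C * frame_sum A x).
  have [spA|nspA] := eqVneq <<[seq f j | j in A]>>%VS fullv.
    by have [C C0 hC] := spans_lower_bound spA; exists C.
  by exists 0; split=> // spA; rewrite spA eqxx in nspA.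
have [C hC] := fin_all_exists hb.
have C0 A : 0 <= C A by case: (hC A).
(* The summand 1 makes the constant invertible even if every [C A] is 0. *)
exists (1 + \sum_A C A); first by rewrite ltr_pwDl ?sumr_ge0.
move=> A /(proj2 (hC A)) hA x; apply: le_trans (hA x) _.
rewrite ler_wpM2r ?frame_sum_ge0 // (bigD1 A) //= addrCA lerDl.
by rewrite addr_ge0 ?sumr_ge0.
Qed.

(** * Spanning and orthogonal vectors *)

Lemma orthogonal_of_not_spans A : ~ spans f A ->
  exists2 x, x != 0 & forall j, j \in A -> dot x (f j) = 0.
Proof.
(* Zero rows outside [A] keep the size [m] without enlarging the row space. *)
move=> nsp; pose M := \matrix_(j < m) (if j \in A then f j else 0).
have nfull : ~~ row_full M.
  apply/negP => /row_fullP[B BM]; apply: nsp; apply/vspaceP => v.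
  rewrite memvf.
  rewrite -[v]mulmx1 -BM mulmxA mulmx_sum_row.
  apply: memv_suml => j _; apply: memvZ; rewrite rowK.
  case: ifP => jA; last exact: mem0v.
  by apply: memv_span; apply: image_f.
have : kermx M^T != 0 by rewrite kermx_eq0 /row_free mxrank_tr.
rewrite -nz_row_eq0; set u := nz_row _ => u0.
have uM : u *m M^T = 0 by apply/sub_kermxP; exact: nz_row_sub.
(* The kernel vector [u] annihilates the rows for the bilinear pairing; [dot] conjugates its second
   argument, so [u] must be conjugated. *)
exists (map_mx conj u).
  apply: contra_neq u0 => /rowP cu0; apply/rowP => i.
  have := cu0 i; rewrite !mxE => /(congr1 conj).
  by rewrite scalar_conjK scalar_conj0.
move=> j jA; rewrite -conj_dot -[RHS]scalar_conj0; congr (conj _).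
have /rowP/(_ j) := uM; rewrite !mxE => <-; apply: eq_bigr => i _.
by rewrite !mxE jA scalar_conjK mulrC.
Qed.

Lemma spans_orthogonal A x : spans f A ->
  (forall j, j \in A -> dot x (f j) = 0) -> x = 0.
Proof.
move=> /spans_lower_bound[C _ /(_ x) hC] xA; apply/eqP.
rewrite -dotxx_eq0 eq_le dotxx_ge0 andbT.
rewrite /frame_sum big1 ?mulr0 // in hC => j jA.
by rewrite xA // normr0 expr0n.
Qed.

(** * Partitions and the product sum *)

Definition partition_spans : Prop :=
  forall F1 F2 : {set 'I_m}, F1 :|: F2 = [set: 'I_m] -> [disjoint F1 & F2] ->
    spans f F1 \/ spans f F2.

Definition product_sum x y : K :=
  \sum_j `|dot x (f j)| ^+ 2 * `|dot y (f j)| ^+ 2.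

Lemma product_term_ge0 x y j : 0 <= `|dot x (f j)| ^+ 2 * `|dot y (f j)| ^+ 2.
Proof. by rewrite mulr_ge0 ?exprn_ge0. Qed.

Lemma product_sum_gt0 : partition_spans ->
  forall x y, x != 0 -> y != 0 -> 0 < product_sum x y.
Proof.
move=> hp x y x0 y0; rewrite lt_def sumr_ge0 => [|j _]; last first.
  exact: product_term_ge0.
rewrite andbT; apply/negP; rewrite psumr_eq0 => [|j _]; last first.
  exact: product_term_ge0.
(* If every term vanishes, [x] is orthogonal to the vectors indexed by [A] and [y] to the remaining
   ones; one of the two families spans. *)
move=> /allP s0; pose A := [set j | dot x (f j) == 0].
have [||sp|sp] := hp A (~: A); rewrite ?setUCr ?disjoints_subset ?setCK //.
- case/eqP: x0; apply: spans_orthogonal sp _ => j.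
  by rewrite inE => /eqP.
- case/eqP: y0; apply: spans_orthogonal sp _ => j.
  rewrite !inE => xj; have := s0 j (mem_index_enum _).
  by rewrite /= mulf_eq0 !sqrf_eq0 !normr_eq0 (negPf xj) => /eqP.
Qed.

(** If neither part spans, nonzero vectors orthogonal to one part each make every term of the
    product sum vanish. *)
Lemma partition_spans_of_gt0 :
  (forall x y, x != 0 -> y != 0 -> 0 < product_sum x y) -> partition_spans.
Proof.
move=> hpos F1 F2 F12 _.
have [|/eqP/orthogonal_of_not_spans[x x0 xF]] :=
  eqVneq <<[seq f j | j in F1]>>%VS fullv; first by left.
have [|/eqP/orthogonal_of_not_spans[y y0 yF]] :=
  eqVneq <<[seq f j | j in F2]>>%VS fullv; first by right.
have := hpos _ _ x0 y0; rewrite /product_sum big1 ?ltxx // => j _.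
have : j \in F1 :|: F2 by rewrite F12.
by rewrite inE => /orP[/xF|/yF] ->; rewrite normr0 expr0n ?mul0r ?mulr0.
Qed.

Lemma product_sum_lower_bound : partition_spans ->
  exists2 a : K, 0 < a & forall x y, a * dot x x * dot y y <= product_sum x y.
Proof.
move=> hp; have [C C0 hC] := uniform_lower_bound.
(* The factor [m.+1] exceeds the number of vectors, which gives a strict contradiction below, and it
   is positive even for [m = 0]. *)
pose D := C * m.+1%:R; have D0 : 0 < D by rewrite mulr_gt0 ?ltr0n.
exists (D * C)^-1 => [|x y]; first by rewrite invr_gt0 mulr_gt0.
rewrite -mulrA ler_pdivrMl ?mulr_gt0 //.
have S0 : 0 <= product_sum x y.
  by rewrite sumr_ge0 // => j _; exact: product_term_ge0.
have [/eqP|x0] := eqVneq x 0.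
  by rewrite -dotxx_eq0 => /eqP ->; rewrite mul0r !mulr_ge0 // ltW.
pose A := [set j | D * `|dot x (f j)| ^+ 2 < dot x x].
have [||sp|sp] := hp A (~: A); rewrite ?setUCr ?disjoints_subset ?setCK //.
(* If [A] spans, its lower bound times [m.+1] meets the sum of at most [m] terms, each below
   [dot x x]. *)
- suff : m.+1%:R * dot x x <= m%:R * dot x x.
    by rewrite ler_pM2r ?dotxx_gt0 // ler_nat ltnn.
  apply: (@le_trans _ _ (D * frame_sum A x)).
    by rewrite /D [C * _]mulrC -mulrA ler_pM2l ?ltr0n // hC.
  apply: (@le_trans _ _ (#|A|%:R * dot x x)).
    rewrite /frame_sum mulr_sumr mulr_natl -sumr_const ler_sum // => j.
    by rewrite inE => /ltW.
  by rewrite ler_pM2r ?dotxx_gt0 // ler_nat -[leqRHS]card_ord max_card.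
(* If the complement spans, the lower bound is used at [y], and each [j] outside [A] satisfies
   $\|x\|^2 \le D|\langle x,f_j\rangle|^2$. *)
- apply: (@le_trans _ _ (C * (dot x x * frame_sum (~: A) y))).
    by rewrite mulrCA ler_wpM2l ?dotxx_ge0 // hC.
  rewrite [D * C]mulrC -mulrA ler_pM2l //.
  rewrite /frame_sum /product_sum !mulr_sumr.
  rewrite [leRHS](bigID (mem (~: A))) /= ler_wpDr //.
    by rewrite sumr_ge0 // => j _; rewrite mulr_ge0 ?product_term_ge0 // ltW.
  rewrite ler_sum // => j; rewrite [leRHS]mulrA !inE => xj.
  rewrite ler_wpM2r ?exprn_ge0 //.
  rewrite real_leNgt ?ger0_real ?dotxx_ge0 // mulr_ge0 ?exprn_ge0 //.
  exact: ltW.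
Qed.

End FrameTheory.

Theorem theorem2p4 (R : realType) (k : scalar_kind) (n m : nat) (hn : (0 < n)%N)
    (f : 'I_m -> 'rV[scalar_field R k]_n) :
  [<->
    (* (1) *)
    forall F1 F2 : {set 'I_m}, F1 :|: F2 = [set: 'I_m] -> [disjoint F1 & F2] ->
      spans f F1 \/ spans f F2;
    (* (2) *)
    forall x y : 'rV[scalar_field R k]_n, x != 0 -> y != 0 ->
      0 < \sum_(j < m) `|dot x (f j)| ^+ 2 * `|dot y (f j)| ^+ 2;
    (* (3) *)
    exists a0 : R, 0 < a0 /\ forall x y : 'rV[scalar_field R k]_n,
      of_real k (a0 * hnorm x ^+ 2 * hnorm y ^+ 2)
        <= \sum_(j < m) `|dot x (f j)| ^+ 2 * `|dot y (f j)| ^+ 2;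
    (* (4) *)
    exists a0 : R, 0 < a0 /\ forall x : 'rV[scalar_field R k]_n,
      form_ge (frame_op f x) (fun z => of_real k (a0 * hnorm x ^+ 2) *: z)
  ].
Proof.
tfae.
- exact: product_sum_gt0.
(* The passage from (2) to (3) goes back through (1). The constant found is a positive scalar, hence
   equal to its real part. *)
- move=> /partition_spans_of_gt0/product_sum_lower_bound[a a0 ha].
  exists (scalar_Re a); rewrite -(of_real_gt0 k) of_real_Re ?ltW //.
  split=> // x y.
  by rewrite 2!of_realM of_real_Re ?(ltW a0) // !of_real_hnorm.
(* The quadratic form of [frame_op f x] at [z] is the product sum of [x] and [z], so the same
   constant works. *)
- move=> [a [a0 ha]]; exists a; split=> // x z.
  by rewrite dot_frame_op dotZl -of_real_hnorm -of_realM.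
(* Evaluating the form at [y] gives (2), which implies (1). *)
- move=> [a [a0 ha]]; apply: partition_spans_of_gt0 => x y x0 y0.
  rewrite /product_sum -dot_frame_op; apply: lt_le_trans (ha x y).
  by rewrite dotZl of_realM of_real_hnorm !mulr_gt0 ?of_real_gt0 ?dotxx_gt0.
Qed.
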